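(* Let $\mathbf{X}\in\mathbb{R}^{m\times n}$, fix $p$ with $0<p<1$, and for each positive integer $d$ define $\theta(d)=\dfrac{p}{d-(d-1)p}$. Consider the problem $$\min_{d,\mathbf{U},\mathbf{V}}\ \mathbb{E}_{\mathbf{r}}\left\|\mathbf{X}-\tfrac{1}{\theta(d)}\mathbf{U}\,\mathrm{diag}(\mathbf{r})\,\mathbf{V}^\top\right\|_F^2,$$ over positive integers $d$, $\mathbf{U}\in\mathbb{R}^{m\times d}$, $\mathbf{V}\in\mathbb{R}^{n\times d}$, where $\mathbf{r}\in\mathbb{R}^d$ has i.i.d. $\mathrm{Bernoulli}(\theta(d))$ entries. Let $\mathbf{U}^{\rm opt}\in\mathbb{R}^{m\times d^{\rm opt}}$, $\mathbf{V}^{\rm opt}\in\mathbb{R}^{n\times d^{\rm opt}}$ attain the global optimum of this problem. Then $\mathbf{A}^{\rm opt}=\mathbf{U}^{\rm opt}(\mathbf{V}^{\rm opt})^\top$ is the global minimizer over $\mathbf{A}\in\mathbb{R}^{m\times n}$ of $$\|\mathbf{X}-\mathbf{A}\|_F^2+\frac{1-p}{p}\|\mathbf{A}\|_\star^2.$$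
   Context: $\|\cdot\|_F$ is the Frobenius norm, $\|\cdot\|_\star$ the nuclear norm (sum of singular values), $\mathrm{diag}(\mathbf{r})$ the diagonal matrix with diagonal $\mathbf{r}$, and $\mathbb{E}_{\mathbf{r}}$ the expectation with respect to $\mathbf{r}$. *)

(* Defs.v *)
From mathcomp Require Import all_boot all_order all_algebra.
From mathcomp Require Import polyrcf.
From mathcomp Require Import reals.
Set Implicit Arguments. Unset Strict Implicit. Unset Printing Implicit Defensive.
Import Order.TTheory GRing.Theory Num.Theory.
Local Open Scope ring_scope.

Section Defs.
Variable R : realType.

Definition frob2 m n (A : 'M[R]_(m, n)) : R := \sum_i \sum_j (A i j) ^+ 2.

(* nuclear norm: sum of singular values, i.e. of the square roots of the
   eigenvalues (with algebraic multiplicity) of A^T A; the eigenvalues are the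
   (real, nonnegative) roots of the characteristic polynomial of A^T A. *)
Definition nuclear m n (A : 'M[R]_(m, n)) : R :=
  let q := char_poly (A^T *m A) in
  \sum_(x <- rootsR q) (mup x q)%:R * Num.sqrt x.

Definition theta (p : R) (d : nat) : R := p / (d%:R - (d%:R - 1) * p).

(* E_r || X - (1/theta(d)) U diag(r) V^T ||_F^2, r in {0,1}^d with i.i.d.
   Bernoulli(theta(d)) entries: the expectation is the finite weighted sum. *)
Definition dropout_obj (p : R) m n d (X : 'M[R]_(m, n))
    (U : 'M[R]_(m, d)) (V : 'M[R]_(n, d)) : R :=
  let t := theta p d in
  \sum_(r : {ffun 'I_d -> bool})
     (\prod_(i < d) (if r i then t else 1 - t)) *
     frob2 (X - t^-1 *: (U *m diag_mx (\row_i (r i)%:R) *m V^T)).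

Definition reg_obj (p : R) m n (X A : 'M[R]_(m, n)) : R :=
  frob2 (X - A) + (1 - p) / p * (nuclear A) ^+ 2.

End Defs.

(* Main.v *)
Require Import Defs.
From mathcomp Require Import all_boot all_order all_algebra.
From mathcomp Require Import polyrcf complex reals ring lra.
Set Implicit Arguments. Unset Strict Implicit. Unset Printing Implicit Defensive.
Import Order.TTheory GRing.Theory Num.Theory.
Local Open Scope ring_scope.

(** Write u_k, v_k for the columns of U, V. Since 1/theta(d) - 1 = d (1 - p) / p,
    taking the expectation turns the dropout objective into
      |X - U V^T|_F^2 + (1 - p)/p * d * sum_k |u_k|^2 |v_k|^2.
    By Cauchy-Schwarz d * sum_k |u_k|^2 |v_k|^2 >= (sum_k |u_k| |v_k|)^2, and
    sum_k |u_k| |v_k| >= |U V^T|_*, so it dominates the regularized objective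
    at U V^T. Conversely, from a singular value decomposition A = P S Q^T and a
    W with orthonormal rows and entries +-1/sqrt d (rows of a Hadamard matrix),
    the factors P S^(1/2) W and Q S^(1/2) W of A have all their columns of squared
    norm |A|_*/d, and both inequalities become equalities. Hence U^opt (V^opt)^T
    minimizes the regularized objective. The minimizer is unique because the
    nuclear norm, as the least value of sum_k |u_k| |v_k| over factorizations,
    is convex, so that the regularized objective is strictly convex. *)

(** * Expectation with respect to a finite product measure *)

Section ProductExpectation.
Variables (R : comNzRingType) (I T : finType) (w : I -> T -> R).

Definition expect (f : {ffun I -> T} -> R) : R :=
  \sum_(r : {ffun I -> T}) (\prod_i w i (r i)) * f r.

Lemma eq_expect f g : f =1 g -> expect f = expect g.
Proof. by move=> fg; apply: eq_bigr => r _; rewrite fg. Qed.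

Lemma expectD f g : expect (fun r => f r + g r) = expect f + expect g.
Proof. by rewrite -big_split; apply: eq_bigr => r _; rewrite mulrDr. Qed.

Lemma expectZ a f : expect (fun r => a * f r) = a * expect f.
Proof. by rewrite mulr_sumr; apply: eq_bigr => r _; rewrite mulrCA. Qed.

Lemma expect_sum (J : finType) (F : J -> {ffun I -> T} -> R) :
  expect (fun r => \sum_j F j r) = \sum_j expect (F j).
Proof. by rewrite exchange_big; apply: eq_bigr => r _; rewrite mulr_sumr. Qed.

Hypothesis sum_w : forall i, \sum_t w i t = 1.

Lemma expect_prod (P : pred I) (g : I -> T -> R) :
  expect (fun r => \prod_(i | P i) g i (r i)) =
  \prod_(i | P i) \sum_t w i t * g i t.
Proof.
transitivity (\prod_i \sum_t w i t * (if P i then g i t else 1)).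
  rewrite bigA_distr_bigA; apply: eq_bigr => r _.
  by rewrite [X in _ * X]big_mkcond -big_split.
rewrite [RHS]big_mkcond; apply: eq_bigr => i _; case: ifP => // _.
by under eq_bigr do rewrite mulr1.
Qed.

Lemma expect_cst c : expect (fun=> c) = c.
Proof. by rewrite /expect -mulr_suml -bigA_distr_bigA big1 ?mul1r. Qed.

Lemma expect_coord k (z : T -> R) :
  expect (fun r => z (r k)) = \sum_t w k t * z t.
Proof.
have := expect_prod (pred1 k) (fun=> z); rewrite big_pred1_eq => <-.
by apply: eq_expect => r; rewrite big_pred1_eq.
Qed.

Lemma expect_coord2 k l (y z : T -> R) : k != l ->
  expect (fun r => y (r k) * z (r l)) =
  (\sum_t w k t * y t) * (\sum_t w l t * z t).
Proof.
move=> kl; pose g i := if i == k then y else z.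
have lk : (l == k) = false by rewrite eq_sym (negPf kl).
have prod_kl (h : I -> R) : \prod_(i in pred2 k l) h i = h k * h l.
  rewrite (bigD1 k) ?inE ?eqxx //= (big_pred1 l) // => i.
  by rewrite !inE; case: eqVneq => [->|]; rewrite /= ?andbF ?andbT ?(negPf kl).
have := expect_prod [in pred2 k l] g; rewrite prod_kl /g eqxx lk => <-.
by apply: eq_expect => r; rewrite (prod_kl (fun i => g i (r i))) /g eqxx lk.
Qed.

Lemma expect_sqr_centered_sum (x : R) (z : I -> T -> R) :
  (forall k, \sum_t w k t * z k t = 0) ->
  expect (fun r => (x - \sum_k z k (r k)) ^+ 2) =
  x ^+ 2 + \sum_k \sum_t w k t * z k t ^+ 2.
Proof.
move=> centered; pose S (r : {ffun I -> T}) := \sum_k z k (r k).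
have expect_S : expect S = 0.
  by rewrite expect_sum big1 // => k _; rewrite expect_coord.
have expect_SS : expect (fun r => S r ^+ 2) = \sum_k \sum_t w k t * z k t ^+ 2.
  under eq_expect do rewrite expr2 mulr_suml.
  rewrite expect_sum; apply: eq_bigr => k _.
  under eq_expect do rewrite mulr_sumr.
  rewrite expect_sum (bigD1 k) //= big1 ?addr0 => [|l lk].
    by rewrite -expect_coord; apply: eq_expect => r; rewrite expr2.
  by rewrite expect_coord2 1?eq_sym // centered mul0r.
transitivity (expect (fun r => x ^+ 2 + (- (2 * x) * S r + S r ^+ 2))).
  by apply: eq_expect => r; rewrite /S; ring.
by rewrite !expectD expect_cst expectZ expect_S mulr0 add0r expect_SS.
Qed.

End ProductExpectation.

Definition bernoulli (R : comNzRingType) (t : R) (b : bool) : R :=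
  if b then t else 1 - t.

Lemma sum_bernoulli (R : comNzRingType) (t : R) (f : bool -> R) :
  \sum_b bernoulli t b * f b = t * f true + (1 - t) * f false.
Proof. by rewrite big_bool. Qed.

(** * Frobenius and column norms *)

Section SqNorm.
Variable R : comNzRingType.

Definition sqnorm m n (A : 'M[R]_(m, n)) : R := \sum_i \sum_j A i j ^+ 2.

Lemma sqnorm_trace m n (A : 'M[R]_(m, n)) : sqnorm A = \tr (A^T *m A).
Proof.
rewrite mxtrace_mulC; apply: eq_bigr => i _; rewrite mxE.
by apply: eq_bigr => j _; rewrite mxE expr2.
Qed.

Lemma mulmx_tr_row n (u : 'rV[R]_n) : u *m u^T = (sqnorm u)%:M.
Proof.
by rewrite [LHS]mx11_scalar sqnorm_trace mxtrace_mulC /mxtrace big_ord1.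
Qed.

Lemma sqnorm_col m n (A : 'M[R]_(m, n)) k :
  sqnorm (col k A) = \sum_i A i k ^+ 2.
Proof. by apply: eq_bigr => i _; rewrite big_ord1 mxE. Qed.

Lemma sqnormZ m n a (A : 'M[R]_(m, n)) : sqnorm (a *: A) = a ^+ 2 * sqnorm A.
Proof.
rewrite mulr_sumr; apply: eq_bigr => i _; rewrite mulr_sumr.
by apply: eq_bigr => j _; rewrite mxE exprMn.
Qed.

Lemma sqnorm_convex_comb m n t (A B : 'M[R]_(m, n)) :
  sqnorm (t *: A + (1 - t) *: B) =
  t * sqnorm A + (1 - t) * sqnorm B - t * (1 - t) * sqnorm (A - B).
Proof.
rewrite /sqnorm !mulr_sumr -sumrN -!big_split; apply: eq_bigr => i _ /=.
rewrite !mulr_sumr -sumrN -!big_split; apply: eq_bigr => j _ /=.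
by rewrite !mxE; ring.
Qed.

Definition orthonormal_cols m n (P : 'M[R]_(m, n)) : Prop := P^T *m P = 1%:M.

Lemma gram_isometry m n r (P : 'M[R]_(m, n)) (A : 'M[R]_(n, r)) :
  orthonormal_cols P -> (P *m A)^T *m (P *m A) = A^T *m A.
Proof. by move=> PP; rewrite trmx_mul mulmxA -(mulmxA _ _ P) PP mulmx1. Qed.

Lemma orthonormal_colsM m n r (P : 'M[R]_(m, n)) (Q : 'M[R]_(n, r)) :
  orthonormal_cols P -> orthonormal_cols Q -> orthonormal_cols (P *m Q).
Proof. by move=> PP QQ; rewrite /orthonormal_cols gram_isometry. Qed.

Lemma sqnorm_isometry m n r (P : 'M[R]_(m, n)) (A : 'M[R]_(n, r)) :
  orthonormal_cols P -> sqnorm (P *m A) = sqnorm A.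
Proof. by move=> PP; rewrite !sqnorm_trace gram_isometry. Qed.

End SqNorm.

Section SqNormOrder.
Variable R : realDomainType.

Lemma sqnorm_ge0 m n (A : 'M[R]_(m, n)) : 0 <= sqnorm A.
Proof. by do 2!apply: sumr_ge0 => ? _; rewrite sqr_ge0. Qed.

Lemma sqnorm_eq0 m n (A : 'M[R]_(m, n)) : (sqnorm A == 0) = (A == 0).
Proof.
apply/idP/eqP => [|->]; last first.
  by rewrite /sqnorm big1 // => i _; rewrite big1 // => j _; rewrite mxE expr0n.
rewrite psumr_eq0 => [/allP rows0|i _]; last first.
  by apply: sumr_ge0 => j _; rewrite sqr_ge0.
apply/matrixP => i j; rewrite mxE; apply/eqP; rewrite -sqrf_eq0.
have := rows0 i (mem_index_enum i); rewrite psumr_eq0 => [/allP|k _].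
  exact.
by rewrite sqr_ge0.
Qed.

Lemma sqnorm_gt0 m n (A : 'M[R]_(m, n)) : (0 < sqnorm A) = (A != 0).
Proof. by rewrite lt0r sqnorm_ge0 andbT sqnorm_eq0. Qed.

Lemma sqnorm_Bessel m n r (P : 'M[R]_(m, n)) (A : 'M[R]_(m, r)) :
  orthonormal_cols P -> sqnorm (P^T *m A) <= sqnorm A.
Proof.
move=> PP; rewrite -subr_ge0; set B := P^T *m A.
suff -> : sqnorm A - sqnorm B = sqnorm (A - P *m B) by apply: sqnorm_ge0.
have BtB : B^T *m B = A^T *m (P *m B) by rewrite trmx_mul trmxK mulmxA.
rewrite !sqnorm_trace [(A - _)^T]linearB /= [(P *m _)^T]trmx_mul.
rewrite mulmxBl !mulmxBr -!mulmxA BtB -/B.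
by rewrite (mulmxA P^T P) PP mul1mx BtB subrr subr0 raddfB.
Qed.

Lemma Cauchy_Schwarz_sum (I : finType) (x y : I -> R) :
  (\sum_i x i * y i) ^+ 2 <= (\sum_i x i ^+ 2) * (\sum_i y i ^+ 2).
Proof.
have : 0 <= \sum_i \sum_j (x i * y j - x j * y i) ^+ 2.
  by apply: sumr_ge0 => i _; apply: sumr_ge0 => j _; rewrite sqr_ge0.
suff -> : \sum_i \sum_j (x i * y j - x j * y i) ^+ 2 =
    ((\sum_i x i ^+ 2) * (\sum_i y i ^+ 2) - (\sum_i x i * y i) ^+ 2) *+ 2.
  by rewrite pmulrn_lge0 // subr_ge0.
rewrite mulrnBl mulr2n {2}[(\sum_i x i ^+ 2) * _]mulrC expr2 !mulr_suml -sumrMnl.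
rewrite -sumrN -!big_split /=; apply: eq_bigr => i _.
rewrite !mulr_sumr -sumrMnl -sumrN -!big_split /=; apply: eq_bigr => j _.
by ring.
Qed.

Lemma sqr_sum_le_card (I : finType) (x : I -> R) :
  (\sum_i x i) ^+ 2 <= #|I|%:R * \sum_i x i ^+ 2.
Proof.
have := Cauchy_Schwarz_sum (fun=> 1) x; under eq_bigr do rewrite mul1r.
by under [X in _ <= X * _]eq_bigr do rewrite expr1n; rewrite sumr_const.
Qed.

End SqNormOrder.

Section ColumnNorm.
Variable R : rcfType.

Definition colnorm m n (A : 'M[R]_(m, n)) (k : 'I_n) : R :=
  Num.sqrt (sqnorm (col k A)).

Lemma colnorm_ge0 m n (A : 'M[R]_(m, n)) k : 0 <= colnorm A k.
Proof. exact: sqrtr_ge0. Qed.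

Lemma sqr_colnorm m n (A : 'M[R]_(m, n)) k :
  colnorm A k ^+ 2 = \sum_i A i k ^+ 2.
Proof. by rewrite sqr_sqrtr ?sqnorm_ge0 // sqnorm_col. Qed.

Lemma colnormZ m n a (A : 'M[R]_(m, n)) k :
  colnorm (a *: A) k = `|a| * colnorm A k.
Proof.
rewrite /colnorm (_ : col k (a *: A) = a *: col k A) ?linearZ //.
by rewrite sqnormZ sqrtrM ?sqr_ge0 // sqrtr_sqr.
Qed.

Lemma colnorm_isometry m n r (P : 'M[R]_(m, n)) (A : 'M[R]_(n, r)) k :
  orthonormal_cols P -> colnorm (P *m A) k = colnorm A k.
Proof. by move=> PP; rewrite /colnorm !colEsub -mulmx_colsub sqnorm_isometry. Qed.

Lemma colnorm_Bessel m n r (P : 'M[R]_(m, n)) (A : 'M[R]_(m, r)) k :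
  orthonormal_cols P -> colnorm (P^T *m A) k <= colnorm A k.
Proof.
by move=> PP; rewrite /colnorm !colEsub -mulmx_colsub ler_wsqrtr ?sqnorm_Bessel.
Qed.

Definition factor_norm m n d (U : 'M[R]_(m, d)) (V : 'M[R]_(n, d)) : R :=
  \sum_k colnorm U k * colnorm V k.

Lemma factor_norm_ge0 m n d (U : 'M[R]_(m, d)) (V : 'M[R]_(n, d)) :
  0 <= factor_norm U V.
Proof. by apply: sumr_ge0 => k _; rewrite mulr_ge0 ?colnorm_ge0. Qed.

Lemma factor_normZ m n d a (U : 'M[R]_(m, d)) (V : 'M[R]_(n, d)) :
  factor_norm (a *: U) V = `|a| * factor_norm U V.
Proof. by rewrite mulr_sumr; apply: eq_bigr => k _; rewrite colnormZ mulrA. Qed.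

Lemma factor_norm_row_mx m n d e (U : 'M[R]_(m, d)) (V : 'M[R]_(n, d))
    (S : 'M[R]_(m, e)) (T : 'M[R]_(n, e)) :
  factor_norm (row_mx U S) (row_mx V T) = factor_norm U V + factor_norm S T.
Proof.
rewrite /factor_norm big_split_ord /=.
by congr (_ + _); apply: eq_bigr => k _; rewrite /colnorm ?colKl ?colKr.
Qed.

Lemma mxtrace_mul_tr_le m d (U V : 'M[R]_(m, d)) :
  \tr (U *m V^T) <= factor_norm U V.
Proof.
rewrite mxtrace_mulC; apply: ler_sum => k _.
rewrite (le_trans (ler_norm _)) // -ler_sqr ?nnegrE ?mulr_ge0 ?colnorm_ge0 //.
rewrite real_normK ?num_real // exprMn !sqr_colnorm mulrC mxE.
by under eq_bigr do rewrite mxE; apply: Cauchy_Schwarz_sum.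
Qed.

Lemma mxtrace_isometry_le m n r d (P : 'M[R]_(m, r)) (Q : 'M[R]_(n, r))
    (U : 'M[R]_(m, d)) (V : 'M[R]_(n, d)) :
  orthonormal_cols P -> orthonormal_cols Q ->
  \tr (P^T *m (U *m V^T) *m Q) <= factor_norm U V.
Proof.
move=> PP QQ.
have -> : P^T *m (U *m V^T) *m Q = P^T *m U *m (Q^T *m V)^T.
  by rewrite trmx_mul trmxK !mulmxA.
apply: le_trans (mxtrace_mul_tr_le _ _) _; apply: ler_sum => k _.
by rewrite ler_pM ?colnorm_ge0 ?colnorm_Bessel.
Qed.

End ColumnNorm.

(** * Spectral theorem for real symmetric matrices *)

Lemma hermitian_eigenvalue_real (C : numClosedFieldType) n (A : 'M[C]_n) z :
  map_mx Num.conj A^T = A -> eigenvalue A z -> z \is Num.real.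
Proof.
move=> hermA /eigenvalueP[v vA v0]; apply/CrealP.
have vA_adj : A *m map_mx Num.conj v^T = z^* *: map_mx Num.conj v^T.
  by rewrite -map_mxZ -[_ *: v^T]linearZ /= -vA trmx_mul map_mxM hermA.
have vv0 : dotmx v v != 0 by rewrite dnorm_eq0.
apply: (mulIf vv0); rewrite dotmxE.
have := mulmxA v A (map_mx Num.conj v^T).
by rewrite vA vA_adj -scalemxAl -scalemxAr => /matrixP/(_ 0 0); rewrite !mxE.
Qed.

Lemma symmetric_eigenvalue (R : rcfType) n (A : 'M[R]_n.+1) :
  A^T = A -> exists a, eigenvalue A a.
Proof.
move=> symA; pose AC := map_mx (real_complex R) A.
have [z zAC] := eigenvalue_closed AC (ltn0Sn n).
have hermAC : map_mx Num.conj AC^T = AC.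
  by apply/matrixP => i j; rewrite !mxE -[in RHS]symA mxE; apply: conjc_real.
have /complex_realP[a za] := hermitian_eigenvalue_real hermAC zAC.
by exists a; move: zAC; rewrite za (eigenvalue_map (real_complex R)).
Qed.

Definition householder (F : fieldType) n (w : 'rV[F]_n) : 'M[F]_n :=
  1%:M - (2 / sqnorm w) *: (w^T *m w).

Lemma tr_householder (F : fieldType) n (w : 'rV[F]_n) :
  (householder w)^T = householder w.
Proof. by rewrite linearB linearZ /= trmx1 trmx_mul trmxK. Qed.

(* When [sqnorm w = 0], the junk value [2 / 0 = 0] makes [householder w] the
   identity. *)
Lemma householderK (F : fieldType) n (w : 'rV[F]_n) :
  householder w *m householder w = 1%:M.
Proof.
rewrite /householder; set c := 2 / _; set W := w^T *m w.
have WW : W *m W = sqnorm w *: W.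
  by rewrite mulmxA -(mulmxA w^T) mulmx_tr_row mul_mx_scalar scalemxAl.
rewrite mulmxBl mul1mx mulmxBr mulmx1 -scalemxAl -scalemxAr WW !scalerA.
suff -> : c * c * sqnorm w = c + c by rewrite scalerDl opprB addrK subrK.
rewrite /c; have [->|w0] := eqVneq (sqnorm w) 0.
  by rewrite invr0 !mulr0 addr0.
by field.
Qed.

Lemma householder_swap (R : realFieldType) n (u v : 'rV[R]_n) :
  sqnorm u = sqnorm v -> u *m householder (u - v) = v.
Proof.
move=> uv; have [->|u_neq_v] := eqVneq u v.
  by rewrite subrr /householder mulmx0 scaler0 subr0 mulmx1.
set w := u - v; have w0 : sqnorm w != 0 by rewrite sqnorm_eq0 subr_eq0.
have [s uw] : exists s, u *m w^T = s%:M by eexists; apply: mx11_scalar.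
have ws : sqnorm w = 2 * s.
  have -> : s = \sum_j u 0 j * w 0 j.
    move/matrixP/(_ 0 0): uw; rewrite !mxE eqxx mulr1n => <-.
    by apply: eq_bigr => j _; rewrite mxE.
  transitivity (2 * \sum_j u 0 j * w 0 j + sqnorm v - sqnorm u).
    rewrite /sqnorm !big_ord1 mulr_sumr -sumrN -!big_split; apply: eq_bigr => j _ /=.
    by rewrite !mxE; ring.
  by rewrite uv addrK.
rewrite /householder -/w mulmxBr mulmx1 -scalemxAr mulmxA uw mul_scalar_mx scalerA.
have -> : 2 / sqnorm w * s = 1 by rewrite mulrAC -ws divff.
by rewrite scale1r opprB addrC subrK.
Qed.

Lemma symmetric_row0_block (R : comNzRingType) n (A : 'M[R]_(1 + n)) a :
  A^T = A -> row 0 A = a *: delta_mx 0 0 ->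
  A = block_mx a%:M 0 0 (drsubmx A).
Proof.
move=> symA row0; have A0 j : A 0 j = a *+ (j == 0).
  by move/rowP/(_ j): row0; rewrite !mxE mulr_natr.
have lshift0 i : lshift n i = 0 :> 'I_(1 + n) by apply: val_inj; rewrite /= ord1.
rewrite -[LHS]submxK; congr block_mx; apply/matrixP => i j.
- by rewrite !mxE !lshift0 A0 !ord1 !eqxx.
- by rewrite !mxE !lshift0 A0.
- by rewrite !mxE !lshift0 -symA mxE A0.
Qed.

Lemma symmetric_orthogonal_deflation (R : rcfType) n (A : 'M[R]_(1 + n)) :
  A^T = A -> exists (H : 'M[R]_(1 + n)) (a : R) (C : 'M[R]_n),
    [/\ orthonormal_cols H, C^T = C & A = H *m block_mx a%:M 0 0 C *m H^T].
Proof.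
move=> symA; have [a /eigenvalueP[v vA v0]] := symmetric_eigenvalue symA.
pose u := (Num.sqrt (sqnorm v))^-1 *: v.
have uA : u *m A = a *: u by rewrite -scalemxAl vA !scalerA mulrC.
have u1 : sqnorm u = 1.
  by rewrite sqnormZ exprVn sqr_sqrtr ?sqnorm_ge0 // mulVf ?sqnorm_eq0.
pose e : 'rV[R]_(1 + n) := delta_mx 0 0.
have e1 : sqnorm e = 1.
  rewrite sqnorm_trace mxtrace_mulC trmx_delta mul_delta_mx.
  by rewrite /mxtrace big_ord1 mxE.
pose H := householder (e - u).
have HT : H^T = H by apply: tr_householder.
have HH : H *m H = 1%:M by apply: householderK.
have eH : e *m H = u by apply: householder_swap; rewrite e1 u1.
pose B := H *m A *m H.
have symB : B^T = B by rewrite /B !trmx_mul symA HT mulmxA.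
have row0B : row 0 B = a *: delta_mx 0 0.
  by rewrite rowE !mulmxA eH uA -scalemxAl -eH -mulmxA HH mulmx1.
exists H, a, (drsubmx B); split; first by rewrite /orthonormal_cols HT.
  by rewrite trmx_drsub symB.
rewrite -(symmetric_row0_block symB row0B) HT.
by rewrite !mulmxA HH mul1mx -mulmxA HH mulmx1.
Qed.

Theorem symmetric_spectral (R : rcfType) n (A : 'M[R]_n) : A^T = A ->
  exists (Q : 'M[R]_n) (mu : 'rV[R]_n),
    orthonormal_cols Q /\ A = Q *m diag_mx mu *m Q^T.
Proof.
elim: n A => [|n IHn] A symA.
  by exists 1%:M, 0; split; apply/matrixP => -[].
have [H [a [C [HH symC ->]]]] := symmetric_orthogonal_deflation symA.
have [Q [mu [QQ ->]]] := IHn C symC.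
pose K : 'M_(1 + n) := block_mx 1%:M 0 0 Q.
have KK : orthonormal_cols K.
  rewrite /orthonormal_cols tr_block_mx !trmx0 trmx1 mulmx_block.
  by rewrite !mulmx0 !mul0mx mulmx1 QQ !addr0 add0r -scalar_mx_block.
exists (H *m K), (row_mx (a%:M : 'M_1) mu); split; first exact: orthonormal_colsM.
suff -> : block_mx a%:M 0 0 (Q *m diag_mx mu *m Q^T) =
    K *m diag_mx (row_mx (a%:M : 'M_1) mu) *m K^T by rewrite trmx_mul !mulmxA.
rewrite diag_mx_row tr_block_mx !trmx0 trmx1 !mulmx_block.
rewrite !mulmx0 !mul0mx !mulmx1 !mul1mx !addr0 !add0r !mul0mx.
by congr block_mx; apply/matrixP => i j; rewrite !ord1 !mxE.
Qed.

(** * Singular values and the nuclear norm *)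

Lemma gram_diag (R : comNzRingType) m n (A : 'M[R]_(m, n)) i :
  (A^T *m A) i i = sqnorm (col i A).
Proof. by rewrite sqnorm_col mxE; apply: eq_bigr => k _; rewrite mxE expr2. Qed.

Lemma mxsub_diag (V : nmodType) m n (f : 'I_m -> 'I_n) (d : 'rV[V]_n) :
  injective f -> mxsub f f (diag_mx d) = diag_mx (colsub f d).
Proof. by move=> injf; apply/matrixP => i j; rewrite !mxE (inj_eq injf). Qed.

Lemma gram_colsub (R : comNzRingType) m n r (f : 'I_r -> 'I_n)
    (A : 'M[R]_(m, n)) :
  (colsub f A)^T *m colsub f A = mxsub f f (A^T *m A).
Proof. by rewrite trmx_mxsub -mxsub_mul. Qed.

Lemma sum_enum_val_support (V : nmodType) (I : finType) (P : pred I)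
    (F : I -> V) :
  (forall i, ~~ P i -> F i = 0) -> \sum_(k < #|P|) F (enum_val k) = \sum_i F i.
Proof.
move=> F0; rewrite -(big_enum_val F) big_mkcond; apply: eq_bigr => i _.
by case: ifPn => // /F0.
Qed.

Lemma svd_orthogonal_cols (R : rcfType) m n (B : 'M[R]_(m, n)) (mu : 'rV[R]_n) :
  B^T *m B = diag_mx mu ->
  exists (r : nat) (P : 'M[R]_(m, r)) (s : 'rV[R]_r) (E : 'M[R]_(n, r)),
    [/\ orthonormal_cols P, orthonormal_cols E, forall k, 0 < s 0 k,
        B = P *m diag_mx s *m E^T & \sum_k s 0 k = \sum_i Num.sqrt (mu 0 i)].
Proof.
move=> BB; have muE i : mu 0 i = sqnorm (col i B).
  by rewrite -gram_diag BB mxE eqxx.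
pose J := [pred i | mu 0 i != 0]; pose f (k : 'I_#|J|) := enum_val k.
have injf : injective f := enum_val_inj.
have mu_gt0 k : 0 < mu 0 (f k).
  by have := enum_valP k; rewrite inE muE sqnorm_eq0 sqnorm_gt0.
pose s : 'rV[R]_#|J| := \row_k Num.sqrt (mu 0 (f k)).
pose sV : 'rV[R]_#|J| := \row_k (s 0 k)^-1.
have sVs : diag_mx sV *m diag_mx s = 1%:M.
  rewrite mulmx_diag -diag_const_mx; congr diag_mx; apply/rowP => k.
  by rewrite !mxE mulVf // gt_eqF // sqrtr_gt0.
have gram_fB : (colsub f B)^T *m colsub f B = diag_mx s *m diag_mx s.
  rewrite gram_colsub BB mxsub_diag // mulmx_diag; congr diag_mx; apply/rowP => k.
  by rewrite !mxE -expr2 sqr_sqrtr ?ltW.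
exists #|J|, (colsub f B *m diag_mx sV), s, (colsub f 1%:M); split => [||k||].
- rewrite /orthonormal_cols trmx_mul tr_diag_mx mulmxA -(mulmxA _ _^T) gram_fB.
  by rewrite !mulmxA sVs mul1mx diag_mxC.
- rewrite /orthonormal_cols gram_colsub trmx1 mulmx1 -diag_const_mx mxsub_diag //.
  by rewrite -diag_const_mx; congr diag_mx; apply/rowP => k; rewrite !mxE.
- by rewrite mxE sqrtr_gt0.
- rewrite -(mulmxA _ (diag_mx sV)) sVs mulmx1 -[LHS]mulmx1.
  apply/matrixP => x y; rewrite !mxE -(@sum_enum_val_support _ _ J) => [|i].
    by apply: eq_bigr => k _; rewrite !mxE eq_sym.
  rewrite negbK muE sqnorm_eq0 => /eqP/colP/(_ x).
  by rewrite !mxE => ->; rewrite mul0r.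
- rewrite -(@sum_enum_val_support _ _ J) => [|i].
    by apply: eq_bigr => k _; rewrite mxE.
  by rewrite negbK => /eqP ->; rewrite sqrtr0.
Qed.

Lemma sum_rootsR_prod_XsubC (R : rcfType) (s : seq R) (f : R -> R) :
  let q := \prod_(y <- s) ('X - y%:P) in
  \sum_(x <- rootsR q) (mup x q)%:R * f x = \sum_(y <- s) f y.
Proof.
move=> q; have q0 : q != 0 by apply/monic_neq0/monic_prod_XsubC.
rewrite -[RHS]big_undup_iterop_count /= (perm_big (undup s)) /=.
  apply: eq_bigr => x _; rewrite mu_prod_XsubC mulr_natl.
  by case: (count_mem x s) => [|k]; rewrite ?mulr0n // -Monoid.iteropE.
apply: uniq_perm; rewrite ?undup_uniq ?uniq_roots // => x.
rewrite mem_undup -[RHS]root_prod_XsubC.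
by have /roots_onP rootsE := roots_on_rootsR q0; rewrite -/q rootsE ?inE.
Qed.

Lemma char_poly_conj (R : comNzRingType) n (P M Q : 'M[R]_n) :
  P *m Q = 1%:M -> char_poly (P *m M *m Q) = char_poly M.
Proof.
move=> PQ; rewrite /char_poly /char_poly_mx !map_mxM /=.
set P' := map_mx _ P; set Q' := map_mx _ Q; set M' := map_mx _ M.
have PQ' : P' *m Q' = 1%:M by rewrite -map_mxM PQ map_mx1.
have -> : 'X%:M - P' *m M' *m Q' = P' *m ('X%:M - M') *m Q'.
  by rewrite mulmxBr mulmxBl mul_mx_scalar -scalemxAl PQ' scalemx1.
by rewrite !det_mulmx mulrAC -det_mulmx PQ' det1 mul1r.
Qed.

Lemma char_poly_diag (R : comNzRingType) n (d : 'rV[R]_n) :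
  char_poly (diag_mx d) = \prod_(x <- [seq d 0 i | i <- enum 'I_n]) ('X - x%:P).
Proof.
rewrite char_poly_trig ?diag_mx_is_trig // big_map big_enum /=.
by apply: eq_bigr => i _; rewrite mxE eqxx.
Qed.

Lemma nuclear_orthogonal_diag (R : realType) m n (A : 'M[R]_(m, n))
    (Q : 'M[R]_n) (mu : 'rV[R]_n) :
  orthonormal_cols Q -> (A *m Q)^T *m (A *m Q) = diag_mx mu ->
  nuclear A = \sum_i Num.sqrt (mu 0 i).
Proof.
move=> QQ gramAQ; rewrite /nuclear.
have -> : char_poly (A^T *m A) = char_poly (diag_mx mu).
  by rewrite -gramAQ trmx_mul !mulmxA -(mulmxA _ A^T) char_poly_conj.
by rewrite char_poly_diag sum_rootsR_prod_XsubC big_map big_enum.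
Qed.

Lemma nuclear_svd (R : realType) m n (A : 'M[R]_(m, n)) :
  exists (r : nat) (P : 'M[R]_(m, r)) (s : 'rV[R]_r) (Q : 'M[R]_(n, r)),
    [/\ orthonormal_cols P, orthonormal_cols Q, forall k, 0 < s 0 k,
        A = P *m diag_mx s *m Q^T & nuclear A = \sum_k s 0 k].
Proof.
have symA : (A^T *m A)^T = A^T *m A by rewrite trmx_mul trmxK.
have [Q [mu [QQ gramA]]] := symmetric_spectral symA.
have gramAQ : (A *m Q)^T *m (A *m Q) = diag_mx mu.
  rewrite trmx_mul !mulmxA -(mulmxA _ A^T) gramA.
  by rewrite !mulmxA QQ mul1mx -mulmxA QQ mulmx1.
have [r [P [s [E [PP EE s_gt0 defAQ sum_s]]]]] := svd_orthogonal_cols gramAQ.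
exists r, P, s, (Q *m E); split=> //; first exact: orthonormal_colsM.
  by rewrite trmx_mul mulmxA -defAQ -mulmxA (mulmx1C QQ) mulmx1.
by rewrite (nuclear_orthogonal_diag QQ gramAQ).
Qed.

Lemma nuclear_ge0 (R : realType) m n (A : 'M[R]_(m, n)) : 0 <= nuclear A.
Proof.
have [r [P [s [Q [_ _ s_gt0 _ ->]]]]] := nuclear_svd A.
by apply: sumr_ge0 => k _; apply: ltW.
Qed.

Lemma nuclear_le_factor_norm (R : realType) m n d (U : 'M[R]_(m, d))
    (V : 'M[R]_(n, d)) :
  nuclear (U *m V^T) <= factor_norm U V.
Proof.
have [r [P [s [Q [PP QQ _ defUV ->]]]]] := nuclear_svd (U *m V^T).
have diag_s : diag_mx s = P^T *m (U *m V^T) *m Q.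
  by rewrite defUV !mulmxA PP mul1mx -mulmxA QQ mulmx1.
by rewrite -mxtrace_diag diag_s mxtrace_isometry_le.
Qed.

(** * Equalized factorizations and convexity of the nuclear norm *)

Definition hadamard (R : comNzRingType) d (H : 'M[R]_d) : Prop :=
  (forall i j, H i j ^+ 2 = 1) /\ H *m H^T = d%:R%:M.

(* Sylvester's doubling construction. *)
Lemma hadamard_double (R : comNzRingType) d (H : 'M[R]_d) :
  hadamard H -> hadamard (block_mx H H H (- H)).
Proof.
move=> [H_sqr HH]; split=> [i j|].
  by case: (split_ordP i) => i' ->; case: (split_ordP j) => j' ->;
    rewrite ?block_mxEul ?block_mxEur ?block_mxEdl ?block_mxEdr ?mxE ?sqrrN H_sqr.
rewrite tr_block_mx mulmx_block linearN /= !mulmxN !mulNmx opprK HH subrr.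
by rewrite -raddfD -natrD -scalar_mx_block.
Qed.

Lemma hadamard_exists_gt (R : comNzRingType) n :
  exists2 d, (n < d)%N & exists H : 'M[R]_d, hadamard H.
Proof.
elim: n => [|n [d n_lt_d [H hadH]]].
  exists 1%N => //; exists 1%:M; split; last by rewrite trmx1 mulmx1.
  by move=> i j; rewrite !ord1 mxE expr1n.
exists (d + d)%N; first by rewrite -addn1 leq_add // (leq_ltn_trans _ n_lt_d).
by exists (block_mx H H H (- H)); apply: hadamard_double.
Qed.

Lemma equimodular_orthonormal_rows (R : rcfType) n :
  exists d (W : 'M[R]_(n, d)),
    [/\ (0 < d)%N, W *m W^T = 1%:M & forall i j, W i j ^+ 2 = d%:R^-1].
Proof.
have [d n_lt_d [H [H_sqr HH]]] := hadamard_exists_gt R n.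
have d_gt0 : (0 < d)%N := leq_ltn_trans (leq0n n) n_lt_d.
have d_neq0 : d%:R != 0 :> R by rewrite pnatr_eq0 -lt0n.
pose c : R := (Num.sqrt d%:R)^-1.
have c2 : c ^+ 2 = d%:R^-1 by rewrite exprVn sqr_sqrtr.
exists d, (c *: rowsub (widen_ord (ltnW n_lt_d)) H); split=> // [|i j]; last first.
  by rewrite !mxE exprMn c2 H_sqr mulr1.
rewrite linearZ /= -scalemxAl -scalemxAr scalerA -expr2 c2.
rewrite trmx_mxsub -mxsub_mul HH.
by apply/matrixP => i j; rewrite !mxE mulrnAr mulVf.
Qed.

Lemma sqr_convex (R : realDomainType) (t a b : R) : 0 <= t <= 1 ->
  (t * a + (1 - t) * b) ^+ 2 <= t * a ^+ 2 + (1 - t) * b ^+ 2.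
Proof.
move=> /andP[t_ge0 t_le1]; rewrite -subr_ge0.
have -> : t * a ^+ 2 + (1 - t) * b ^+ 2 - (t * a + (1 - t) * b) ^+ 2 =
  t * (1 - t) * (a - b) ^+ 2 by ring.
by rewrite mulr_ge0 ?sqr_ge0 // mulr_ge0 ?subr_ge0.
Qed.

Section NuclearNorm.
Variable R : realType.

Lemma equalized_factorization m n (A : 'M[R]_(m, n)) :
  exists d (U : 'M[R]_(m, d)) (V : 'M[R]_(n, d)),
    [/\ (0 < d)%N, A = U *m V^T &
        forall k, colnorm U k * colnorm V k = nuclear A / d%:R].
Proof.
have [r [P [s [Q [PP QQ s_gt0 -> ->]]]]] := nuclear_svd A.
have [d [W [d_gt0 WW W_sqr]]] := equimodular_orthonormal_rows R r.
pose D := diag_mx (\row_i Num.sqrt (s 0 i)).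
have DD : D *m D = diag_mx s.
  rewrite mulmx_diag; congr diag_mx; apply/rowP => i.
  by rewrite !mxE -expr2 sqr_sqrtr ?ltW.
exists d, (P *m (D *m W)), (Q *m (D *m W)); split=> // [|k].
  by rewrite !trmx_mul tr_diag_mx !mulmxA -(mulmxA _ W) WW mulmx1 -DD !mulmxA.
rewrite (colnorm_isometry _ _ PP) (colnorm_isometry _ _ QQ) -expr2 sqr_colnorm.
rewrite mulr_suml; apply: eq_bigr => i _.
by rewrite mul_diag_mx !mxE exprMn W_sqr sqr_sqrtr ?ltW.
Qed.

Lemma factor_norm_attains_nuclear m n (A : 'M[R]_(m, n)) :
  exists d (U : 'M[R]_(m, d)) (V : 'M[R]_(n, d)),
    A = U *m V^T /\ factor_norm U V = nuclear A.
Proof.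
have [d [U [V [d_gt0 defA UV]]]] := equalized_factorization A.
exists d, U, V; split=> //; rewrite /factor_norm; under eq_bigr do rewrite UV.
by rewrite sumr_const card_ord -(mulr_natr (_ / _)) divfK // pnatr_eq0 -lt0n.
Qed.

Lemma ler_nuclearD m n (A B : 'M[R]_(m, n)) :
  nuclear (A + B) <= nuclear A + nuclear B.
Proof.
have [d [U [V [-> <-]]]] := factor_norm_attains_nuclear A.
have [e [S [T [-> <-]]]] := factor_norm_attains_nuclear B.
by rewrite -factor_norm_row_mx -mul_row_col -tr_row_mx nuclear_le_factor_norm.
Qed.

Lemma ler_nuclearZ m n a (A : 'M[R]_(m, n)) :
  nuclear (a *: A) <= `|a| * nuclear A.
Proof.
have [d [U [V [-> <-]]]] := factor_norm_attains_nuclear A.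
by rewrite -factor_normZ scalemxAl nuclear_le_factor_norm.
Qed.

Lemma nuclear_convex m n t (A B : 'M[R]_(m, n)) : 0 <= t <= 1 ->
  nuclear (t *: A + (1 - t) *: B) <= t * nuclear A + (1 - t) * nuclear B.
Proof.
move=> /andP[t_ge0 t_le1]; rewrite (le_trans (ler_nuclearD _ _)) // lerD //.
  by rewrite (le_trans (ler_nuclearZ _ _)) ?ger0_norm.
by rewrite (le_trans (ler_nuclearZ _ _)) ?ger0_norm ?subr_ge0.
Qed.

Lemma sqr_nuclear_convex m n t (A B : 'M[R]_(m, n)) : 0 <= t <= 1 ->
  nuclear (t *: A + (1 - t) *: B) ^+ 2 <=
  t * nuclear A ^+ 2 + (1 - t) * nuclear B ^+ 2.
Proof.
move=> t01; have convex := nuclear_convex A B t01.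
apply: le_trans (sqr_convex _ _ t01).
by rewrite ler_sqr ?nnegrE ?(le_trans _ convex) ?nuclear_ge0.
Qed.

End NuclearNorm.

(** * The dropout objective *)

Lemma expect_sqr_dropout (F : fieldType) (I : finType) (t x : F) (c : I -> F) :
  t != 0 ->
  expect (fun=> bernoulli t)
    (fun r : {ffun I -> bool} => (x - t^-1 * \sum_k c k * (r k)%:R) ^+ 2) =
  (x - \sum_k c k) ^+ 2 + (t^-1 - 1) * \sum_k c k ^+ 2.
Proof.
move=> t0; pose z k (b : bool) := c k * (t^-1 * b%:R - 1).
have sum_w (i : I) : \sum_b bernoulli t b = 1.
  by rewrite big_bool /= subrKC.
have centered k : \sum_b bernoulli t b * z k b = 0.
  by rewrite sum_bernoulli /z /=; field.
transitivity (expect (fun=> bernoulli t)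
    (fun r => (x - \sum_k c k - \sum_k z k (r k)) ^+ 2)).
  apply: eq_expect => r; congr (_ ^+ 2).
  rewrite -addrA -opprD -big_split mulr_sumr; congr (_ - _).
  by apply: eq_bigr => k _ /=; rewrite /z; ring.
rewrite expect_sqr_centered_sum //; congr (_ + _); rewrite mulr_sumr.
by apply: eq_bigr => k _; rewrite sum_bernoulli /z /=; field.
Qed.

Lemma expect_sqnorm_dropout (R : rcfType) m n d (t : R) (X : 'M[R]_(m, n))
    (U : 'M[R]_(m, d)) (V : 'M[R]_(n, d)) : t != 0 ->
  expect (fun=> bernoulli t)
    (fun r => sqnorm (X - t^-1 *: (U *m diag_mx (\row_i (r i)%:R) *m V^T))) =
  sqnorm (X - U *m V^T) + (t^-1 - 1) * \sum_k (colnorm U k * colnorm V k) ^+ 2.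
Proof.
move=> t0; have entry (r : {ffun 'I_d -> bool}) i j :
    (X - t^-1 *: (U *m diag_mx (\row_i (r i)%:R) *m V^T)) i j =
    X i j - t^-1 * \sum_k U i k * V j k * (r k)%:R.
  rewrite mul_mx_diag !mxE; congr (_ - _ * _); apply: eq_bigr => k _.
  by rewrite !mxE mulrAC.
transitivity (\sum_i \sum_j
    ((X i j - \sum_k U i k * V j k) ^+ 2 +
     (t^-1 - 1) * \sum_k (U i k * V j k) ^+ 2)).
  rewrite /sqnorm expect_sum; apply: eq_bigr => i _; rewrite expect_sum.
  apply: eq_bigr => j _; rewrite -expect_sqr_dropout //.
  by apply: eq_expect => r; rewrite entry.
under eq_bigr do rewrite big_split -mulr_sumr /=.
rewrite big_split -mulr_sumr /=; congr (_ + _ * _).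
  apply: eq_bigr => i _; apply: eq_bigr => j _; rewrite !mxE.
  by congr ((_ - _) ^+ 2); apply: eq_bigr => k _; rewrite mxE.
under eq_bigr do rewrite exchange_big /=.
rewrite exchange_big; apply: eq_bigr => k _ /=.
rewrite exprMn !sqr_colnorm mulr_suml; apply: eq_bigr => i _.
by rewrite mulr_sumr; apply: eq_bigr => j _; rewrite exprMn.
Qed.

Section Objectives.
Variables (R : realType) (p : R).
Hypotheses (p_gt0 : 0 < p) (p_lt1 : p < 1).

Lemma theta_neq0 d : theta p d != 0.
Proof.
rewrite gt_eqF // divr_gt0 //.
have -> : d%:R - (d%:R - 1) * p = d%:R * (1 - p) + p by ring.
by rewrite ltr_wpDl // mulr_ge0 // subr_ge0 ltW.
Qed.

Lemma inv_theta_sub1 d : (theta p d)^-1 - 1 = d%:R * ((1 - p) / p).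
Proof. by rewrite invf_div; field; rewrite gt_eqF. Qed.

Lemma penalty_ge0 : 0 <= (1 - p) / p.
Proof. by rewrite divr_ge0 ?subr_ge0 ?ltW. Qed.

Lemma dropout_objE m n d (X : 'M[R]_(m, n)) (U : 'M[R]_(m, d))
    (V : 'M[R]_(n, d)) :
  dropout_obj p X U V = frob2 (X - U *m V^T) +
    (1 - p) / p * (d%:R * \sum_k (colnorm U k * colnorm V k) ^+ 2).
Proof.
rewrite mulrA [_ * d%:R]mulrC -inv_theta_sub1.
(* [dropout_obj] unfolds to an [expect], and [frob2] to [sqnorm]. *)
exact: expect_sqnorm_dropout (theta_neq0 d).
Qed.

Lemma reg_obj_le_dropout_obj m n d (X : 'M[R]_(m, n)) (U : 'M[R]_(m, d))
    (V : 'M[R]_(n, d)) :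
  reg_obj p X (U *m V^T) <= dropout_obj p X U V.
Proof.
rewrite dropout_objE lerD2l ler_wpM2l ?penalty_ge0 //.
apply: (@le_trans _ _ (factor_norm U V ^+ 2)).
  rewrite ler_sqr ?nnegrE ?nuclear_ge0 ?factor_norm_ge0 //.
  exact: nuclear_le_factor_norm.
by rewrite (le_trans (sqr_sum_le_card _)) // card_ord.
Qed.

Lemma dropout_obj_attains_reg_obj m n (X A : 'M[R]_(m, n)) :
  exists d (U : 'M[R]_(m, d)) (V : 'M[R]_(n, d)),
    (0 < d)%N /\ dropout_obj p X U V = reg_obj p X A.
Proof.
have [d [U [V [d_gt0 defA UV]]]] := equalized_factorization A.
exists d, U, V; split=> //; rewrite dropout_objE -defA; congr (_ + _ * _).
under eq_bigr do rewrite UV.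
have d_neq0 : d%:R != 0 :> R by rewrite pnatr_eq0 -lt0n.
by rewrite sumr_const card_ord -(mulr_natl (_ ^+ 2)); field.
Qed.

Lemma reg_obj_strictly_convex m n t (X A B : 'M[R]_(m, n)) :
  0 < t < 1 -> A <> B ->
  reg_obj p X (t *: A + (1 - t) *: B) <
  t * reg_obj p X A + (1 - t) * reg_obj p X B.
Proof.
move=> /andP[t_gt0 t_lt1] AB; have t01 : 0 <= t <= 1 by rewrite !ltW.
have residual : X - (t *: A + (1 - t) *: B) = t *: (X - A) + (1 - t) *: (X - B).
  by apply/matrixP => i j; rewrite !mxE; ring.
have gap : 0 < t * (1 - t) * frob2 (X - A - (X - B)).
  have -> : X - A - (X - B) = B - A by apply/matrixP => i j; rewrite !mxE; ring.
  by rewrite !mulr_gt0 ?subr_gt0 // sqnorm_gt0 subr_eq0 eq_sym; apply/eqP.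
have fit : frob2 (t *: (X - A) + (1 - t) *: (X - B)) =
    t * frob2 (X - A) + (1 - t) * frob2 (X - B) -
    t * (1 - t) * frob2 (X - A - (X - B)) by apply: sqnorm_convex_comb.
have penalty := ler_wpM2l penalty_ge0 (sqr_nuclear_convex A B t01).
by rewrite /reg_obj residual fit; lra.
Qed.

End Objectives.

Theorem theorem3 (R : realType) (m n : nat) (X : 'M[R]_(m, n)) (p : R)
  (hp0 : 0 < p) (hp1 : p < 1)
  (dopt : nat) (Uopt : 'M[R]_(m, dopt)) (Vopt : 'M[R]_(n, dopt))
  (hdopt : (0 < dopt)%N)
  (hopt : forall (d : nat) (U : 'M[R]_(m, d)) (V : 'M[R]_(n, d)),
      (0 < d)%N -> dropout_obj p X Uopt Vopt <= dropout_obj p X U V) :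
  forall A : 'M[R]_(m, n), A <> Uopt *m Vopt^T ->
    reg_obj p X (Uopt *m Vopt^T) < reg_obj p X A.
Proof.
set Aopt := Uopt *m Vopt^T => A A_neq.
have Aopt_min B : reg_obj p X Aopt <= reg_obj p X B.
  have [d [U [V [d_gt0 <-]]]] := dropout_obj_attains_reg_obj hp0 hp1 X B.
  exact: le_trans (reg_obj_le_dropout_obj _ _ _ _ _) (hopt _ _ _ d_gt0).
have half_in01 : 0 < (2^-1 : R) < 1 by rewrite invr_gt0 invf_lt1 ?ltr1n ?ltr0n.
have := reg_obj_strictly_convex hp0 hp1 X half_in01 A_neq.
move/(le_lt_trans (Aopt_min _)); lra.
Qed.
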